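(* Let $R$ be a commutative ring, $I$ a nonzero proper ideal of $R$, $M$ an $R$-module, and $N$ a submodule of $M$. Then $I (+) N$ is an sdf-absorbing ideal of $R (+) M$ if and only if $I$ is an sdf-absorbing ideal of $R$ and $N = M$.
   Context: All rings are commutative with identity $1 \neq 0$. A proper ideal $I$ of a commutative ring $R$ is a square-difference factor absorbing ideal (sdf-absorbing ideal) of $R$ if whenever $a, b \in R$ are both nonzero and $a^2 - b^2 \in I$, then $a + b \in I$ or $a - b \in I$. For a commutative ring $R$ and an $R$-module $M$, the idealization $R(+)M$ is the commutative ring with underlying set $R \times M$, identity $(1,0)$, addition $(r,m) + (s,n) = (r+s, m+n)$, and multiplication $(r,m)(s,n) = (rs, rn + sm)$. For an ideal $I$ of $R$ and a submodule $N$ of $M$, $I(+)N$ denotes the subset $I \times N$ of $R(+)M$; the assertion that it is an sdf-absorbing ideal includes the assertion that it is an ideal. *)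

(* Defs.v *)
From HB Require Import structures.
From mathcomp Require Import all_boot all_order all_algebra.
From mathcomp Require Import boolp classical_sets.
Set Implicit Arguments.
Unset Strict Implicit.
Unset Printing Implicit Defensive.
Import GRing.Theory.
Local Open Scope classical_set_scope.
Local Open Scope ring_scope.

(* An alias of [R * M], because the product type already carries the
   componentwise operations; only its additive structure is reused. *)
Definition idealization (R : comNzRingType) (M : lmodType R) : Type :=
  (R * M)%type.

HB.instance Definition _ (R : comNzRingType) (M : lmodType R) :=
  GRing.Zmodule.copy (idealization M) (R * M)%type.

Section IdealizationRing.
Variables (R : comNzRingType) (M : lmodType R).
Implicit Types x y z : idealization M.

Definition idealization_one : idealization M := (1, 0).

Definition idealization_mul x y : idealization M :=
  (x.1 * y.1, x.1 *: y.2 + y.1 *: x.2).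

Fact idealization_mulA : associative idealization_mul.
Proof.
move=> [r m] [s n] [t p]; rewrite /idealization_mul /=.
congr pair; first exact: mulrA.
by rewrite !scalerDr !scalerA addrA (mulrC t r) (mulrC t s).
Qed.

Fact idealization_mulC : commutative idealization_mul.
Proof.
by move=> [r m] [s n]; rewrite /idealization_mul /= mulrC addrC.
Qed.

Fact idealization_mul1 : left_id idealization_one idealization_mul.
Proof.
by move=> [r m]; rewrite /idealization_mul /= mul1r scale1r scaler0 addr0.
Qed.

Fact idealization_mulDl : left_distributive idealization_mul +%R.
Proof.
move=> [r m] [s n] [t p]; rewrite /idealization_mul /=.
by congr pair; rewrite ?mulrDl // scalerDl scalerDr addrACA.
Qed.

Fact idealization_one_neq0 : idealization_one != 0.
Proof. by apply/eqP => -[] /eqP; rewrite oner_eq0. Qed.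

HB.instance Definition _ := GRing.Zmodule_isComNzRing.Build (idealization M)
  idealization_mulA idealization_mulC idealization_mul1 idealization_mulDl
  idealization_one_neq0.

End IdealizationRing.

(* The subset I (+) N = I x N of R (+) M. *)
Definition idealization_set (R : comNzRingType) (M : lmodType R)
    (I : set R) (N : set M) : set (idealization M) :=
  I `*` N.

(* [idealr_closed] contains the properness condition [1 \notin I]. *)
Definition sdf_absorbing (R : comNzRingType) (I : set R) : Prop :=
  idealr_closed [in I] /\
  forall a b : R, a != 0 -> b != 0 ->
    a ^+ 2 - b ^+ 2 \in I -> a + b \in I \/ a - b \in I.

(* Main.v *)
Require Import Defs.
From mathcomp Require Import all_boot all_order all_algebra.
From mathcomp Require Import boolp classical_sets.
Local Open Scope classical_set_scope.
Local Open Scope ring_scope.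

(** The implication from [R (+) M] to [R] restricts the absorbing property to
    the subring [R x 0].  To see that it forces [N = M], fix a nonzero [i] in
    [I].  Since [I (+) N] is an ideal, [(i, 0) * (0, m) = (0, i m)] shows
    [I M <= N].  Hence, for any [m], the nonzero elements [(i, m)] and [(i, 0)]
    have a difference of squares [(0, 2 i m)] in [I (+) N], while both their sum
    and their difference have second component [m]; so [m] is in [N].

    Conversely, when [N = M], membership in [I (+) M] only concerns first
    components.  The obstacle is that a nonzero pair may have first component
    [0], in which case the absorbing property of [I] does not apply.  This is
    repaired by [sdf_absorbing_sqr]: a nonzero sdf-absorbing ideal is radical,
    because a nonzero element of the ideal can stand in for [0]. *)

Import GRing.Theory.
Set Implicit Arguments.
Unset Strict Implicit.

Lemma idealization_sqrB (R : comNzRingType) (M : lmodType R)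
    (x y : idealization M) :
  x ^+ 2 - y ^+ 2
    = (x.1 ^+ 2 - y.1 ^+ 2, (x.1 *: x.2) *+ 2 - (y.1 *: y.2) *+ 2).
Proof. by []. Qed.

Lemma in_idealization_set (R : comNzRingType) (M : lmodType R)
    (I : set R) (N : set M) (x : idealization M) :
  (x \in idealization_set I N) = (x.1 \in I) && (x.2 \in N).
Proof. exact: in_setX. Qed.

Section IdealClosure.
Variables (R : comNzRingType) (I : set R).
Hypothesis idealI : idealr_closed [in I].

Lemma ideal_addr (u v : R) : u \in I -> v \in I -> u + v \in I.
Proof. by case: idealI => _ _ + uI vI => /(_ 1 u v uI vI); rewrite mul1r. Qed.

Lemma ideal_mull (a u : R) : u \in I -> a * u \in I.
Proof. by case: idealI => I0 _ + uI => /(_ a u 0 uI I0); rewrite addr0. Qed.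

Lemma ideal_oppr (u : R) : u \in I -> - u \in I.
Proof. by move=> /(ideal_mull (-1)); rewrite mulN1r. Qed.

Lemma ideal_subr (u v : R) : u \in I -> v \in I -> u - v \in I.
Proof. by move=> uI /ideal_oppr; apply: ideal_addr. Qed.

Lemma ideal_neq0_ex : I <> [set 0] -> exists2 i, i \in I & i != 0.
Proof.
move=> In0; apply: contrapT => noI; apply: In0.
have /set_mem I0 : 0 \in I by case: idealI.
apply/seteqP; split=> [i Ii|_ -> //]; apply/eqP; apply: contrapT => /negP i0.
by apply: noI; exists i => //; apply: mem_set.
Qed.

End IdealClosure.

(** Compare [b] with a nonzero [i] in [I]: both [b ^+ 2] and [i ^+ 2] are in
    [I], hence [b + i] or [b - i] is, and therefore [b] too. *)
Lemma sdf_absorbing_sqr (R : comNzRingType) (I : set R) (b : R) :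
  sdf_absorbing I -> I <> [set 0] -> b ^+ 2 \in I -> b \in I.
Proof.
move=> [idealI sdfI] /(ideal_neq0_ex idealI)[i iI i0] b2I.
have [->|b0] := eqVneq b 0; first by case: idealI.
have i2I : i ^+ 2 \in I by rewrite expr2; apply: ideal_mull.
case: (sdfI b i b0 i0 (ideal_subr idealI b2I i2I)) => biI.
  by rewrite -(addrK i b); apply: ideal_subr.
by rewrite -(subrK i b); apply: ideal_addr.
Qed.

(** A zero argument leaves, up to sign, the square of the other one in [I],
    which [sdf_absorbing_sqr] turns into membership.  This covers the elements
    of [R (+) M] that are nonzero although their first component is [0]. *)
Lemma sdf_absorbing_total (R : comNzRingType) (I : set R) (a b : R) :
    sdf_absorbing I -> I <> [set 0] -> a ^+ 2 - b ^+ 2 \in I ->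
  a + b \in I \/ a - b \in I.
Proof.
move=> sdfI In0.
have [->|a0] := eqVneq a 0.
  rewrite expr0n sub0r add0r => /(ideal_oppr sdfI.1).
  by rewrite opprK => /(sdf_absorbing_sqr sdfI In0); left.
have [->|b0] := eqVneq b 0; last exact: sdfI.2.
rewrite expr0n subr0 addr0 => /(sdf_absorbing_sqr sdfI In0).
by left.
Qed.

Lemma idealization_set_setT_ideal (R : comNzRingType) (M : lmodType R)
    (I : set R) :
  idealr_closed [in I] -> idealr_closed [in idealization_set I [set: M]].
Proof.
move=> [I0 I1 Ilin]; split; rewrite /= ?in_idealization_set ?in_setT ?andbT //.
move=> a u v; rewrite !in_idealization_set !in_setT !andbT; exact: Ilin.
Qed.

Lemma idealization_set_setT_sdf (R : comNzRingType) (M : lmodType R)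
    (I : set R) :
    I <> [set 0] -> sdf_absorbing I ->
  sdf_absorbing (idealization_set I [set: M]).
Proof.
move=> In0 sdfI; split; first exact: idealization_set_setT_ideal sdfI.1.
move=> x y _ _; rewrite idealization_sqrB !in_idealization_set !in_setT !andbT.
exact: sdf_absorbing_total.
Qed.

Lemma sdf_absorbing_idealization_fst (R : comNzRingType) (M : lmodType R)
    (I : set R) (N : set M) :
    idealr_closed [in I] -> sdf_absorbing (idealization_set I N) ->
  sdf_absorbing I.
Proof.
move=> idealI [[IN0 _ _] sdfIN]; split=> // a b a0 b0 abI.
have N0 : 0 \in N by move: IN0; rewrite in_idealization_set => /andP[].
have pair_neq0 (r : R) : r != 0 -> ((r, 0) : idealization M) != 0.
  by apply: contra_neq => -[].
have := sdfIN _ _ (pair_neq0 a a0) (pair_neq0 b b0).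
rewrite idealization_sqrB !in_idealization_set /= !scaler0 !mul0rn subrr.
by rewrite abI N0 => /(_ isT)[/andP[]|/andP[]]; [left|right].
Qed.

(** [i *: m] is the second component of [(i, 0) * (0, m)], a multiple of an
    element of [I (+) N]. *)
Lemma idealization_ideal_scale (R : comNzRingType) (M : lmodType R)
    (I : set R) (N : set M) (i : R) (m : M) :
  idealr_closed [in idealization_set I N] -> i \in I -> i *: m \in N.
Proof.
move=> idealIN iI.
have N0 : 0 \in N by case: idealIN; rewrite /= in_idealization_set => /andP[].
have : ((i, 0) : idealization M) \in idealization_set I N.
  by rewrite in_idealization_set iI.
move=> /(ideal_mull idealIN ((0, m) : idealization M)).
by rewrite in_idealization_set /= scale0r add0r => /andP[].
Qed.

Lemma sdf_absorbing_idealization_snd (R : comNzRingType) (M : lmodType R)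
    (I : set R) (N : set M) :
    idealr_closed [in I] -> I <> [set 0] ->
  sdf_absorbing (idealization_set I N) -> N = [set: M].
Proof.
move=> idealI In0 [idealIN sdfIN].
have [i iI i0] := ideal_neq0_ex idealI In0.
apply/seteqP; split=> // m _; apply: set_mem.
have pair_neq0 (n : M) : ((i, n) : idealization M) != 0.
  by apply: contra_neq i0 => -[].
have := sdfIN _ _ (pair_neq0 m) (pair_neq0 0).
rewrite idealization_sqrB !in_idealization_set /= !subrr.
rewrite scaler0 mul0rn subr0 addr0.
have -> : 0 \in I by case: idealI.
(* [2 i m = i (2 m)] lies in [I M], hence in [N]. *)
rewrite scalerMnr (idealization_ideal_scale _ idealIN iI).
by case=> // /andP[_]; rewrite ?subr0.
Qed.

Unset Implicit Arguments.
Set Strict Implicit.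

Theorem theorem4p16 (R : comNzRingType) (I : set R) (M : lmodType R)
    (N : set M)
    (hI : idealr_closed [in I]) (hI0 : I <> [set 0])
    (hN : submod_closed [in N]) :
  sdf_absorbing (idealization_set I N) <-> sdf_absorbing I /\ N = [set: M].
Proof.
split=> [sdfIN|[sdfI ->]]; last exact: idealization_set_setT_sdf.
split; first exact: sdf_absorbing_idealization_fst sdfIN.
exact: sdf_absorbing_idealization_snd sdfIN.
Qed.
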